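(* There is a positive constant $c_2$ such that the following holds. Let $p$ be a prime, let $1\le m\le p$ be an integer, and let $A$ be an incomplete sequence of $\mathbb{Z}_p$ with $m(A)\le m$. Then there exist a non-zero element $b\in\mathbb{Z}_p$ and a subsequence $A^{\flat}\subset A$ with $|A^{\flat}|\le c_2 f(p,m)$ such that $$\sum_{a\in b\cdot (A\setminus A^{\flat})}\|a\|<p.$$
   Context: $\mathbb{Z}_p$ is the cyclic group of prime order $p$. A sequence of $\mathbb{Z}_p$ is a finite multiset of elements of $\mathbb{Z}_p$; $m(A)$ is the maximum multiplicity of an element in $A$ (throughout, $m(A)\le p$). Subsequences, differences and cardinalities are taken with multiplicity. $\sum(A)$ is the set of sums $\sum_{x\in B}x$ over non-empty subsequences $B\subset A$; $A$ is complete if $\sum(A)=\mathbb{Z}_p$ and incomplete otherwise. For $b\in\mathbb{Z}_p$, $b\cdot A=\{ba:a\in A\}$ (as a sequence). For $x\in\mathbb{Z}_p$, $\|x\|$ is the distance from $x$ to $0$, i.e. $\min(r,p-r)$ where $r\in\{0,\dots,p-1\}$ represents $x$. $f(p,m):=\lfloor (pm)^{6/13}\log^2 p\rfloor$. *)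

(* Defs.v *)
From mathcomp Require Import all_boot all_order all_algebra.
From mathcomp Require Import finmap multiset.
From mathcomp Require Import all_classical all_reals all_analysis.

Set Implicit Arguments.
Unset Strict Implicit.
Unset Printing Implicit Defensive.

Import Order.TTheory GRing.Theory Num.Theory.

Local Open Scope ring_scope.

(* For p prime, Z_p is the prime field 'F_p; a finite sequence of Z_p, taken
   up to reordering, is a multiset A : {mset 'F_p}, in which x has
   multiplicity A x.  When A is used as a list (size, big operators) its
   elements are repeated according to their multiplicities. *)

Definition max_mult (p : nat) (A : {mset 'F_p}%mset) : nat :=
  (\max_(x : 'F_p) A x)%N.

Definition subset_sums (p : nat) (A : {mset 'F_p}%mset) : set 'F_p :=
  [set s : 'F_p | exists B : {mset 'F_p}%mset,
     [/\ (B `<=` A)%mset, B != mset0 & s = \sum_(x <- B) x]]%classic.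

Definition complete (p : nat) (A : {mset 'F_p}%mset) : Prop :=
  subset_sums A = [set: 'F_p]%classic.

Definition incomplete (p : nat) (A : {mset 'F_p}%mset) : Prop := ~ complete A.

Definition dilate (p : nat) (b : 'F_p) (A : {mset 'F_p}%mset) :
    {mset 'F_p}%mset :=
  seq_mset [seq b * a | a <- A].

(* The coercion 'F_p >-> nat gives the representative in {0, ..., p - 1}
   when p is prime. *)
Definition dist0 (p : nat) (x : 'F_p) : nat := minn x (p - x)%N.

Definition f (R : realType) (p m : nat) : int :=
  Num.floor (((p * m)%:R : R) `^ (6%:R / 13%:R) * ln (p%:R : R) ^+ 2).

(* Main.v *)
Require Import Defs.
From mathcomp Require Import all_boot all_order all_algebra zify.

Import Order.TTheory GRing.Theory Num.Theory.

Local Open Scope ring_scope.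

(* If A is incomplete, the Fourier expansion of the number of signed sums gives
   a dilation of A with sum of ||a||^2 at most p^2 log p, so all but n elements
   are integers in [-M, M] with M about p sqrt(log p / n).  Let A1 and A2 be
   the n smallest and the n largest of these.  By dyadic pigeonhole many
   differences of A2 - A1 lie in a set E of differences d having about the same
   number rho of representations, and sums of at most L = rho / (2 m) elements
   of E are, up to the translation by the sum of A1, subset sums of A1 and A2,
   since an element used once spoils at most m representations of a given d.
   Modulo q = max E, Olson's theorem shows that few elements of E generate a
   subgroup; adding copies of q, these sums contain all multiples of some g in
   an interval much longer than g M.  At most g - 1 further elements cover the
   residues modulo g that the others can reach; all remaining elements are
   then divisible by a divisor g' of g and simply lengthen the progression of
   difference g'.  As A is incomplete, its length stays below p, and dilating
   by 1 / g' gives the claim.  The argument needs n^2 >= C m M log p, that is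
   n of order (pm)^(2/5) up to logarithms, which f(p, m) exceeds. *)

(** * Growth of sumsets in finite abelian groups *)

Section Sumset.
Variable G : finZmodType.
Implicit Types A B X : {set G}.

Definition sumset A B : {set G} := [set a + b | a in A, b in B].

Lemma mem_sumset A B a b : a \in A -> b \in B -> a + b \in sumset A B.
Proof. exact: imset2_f. Qed.

Lemma sumset_subl A B : 0 \in B -> A \subset sumset A B.
Proof. by move=> B0; apply/subsetP => a aA; rewrite -[a]addr0 mem_sumset. Qed.

Definition translation_closed B X := forall b x, b \in B -> x \in X -> b + x \in B.

Lemma card_translate A x : #|[set a + x | a in A]| = #|A|.
Proof. by apply: card_imset; apply: addIr. Qed.

(* Olson's theorem in the abelian case, by Dyson's transform: push into [B]
   the elements of [e + X] outside [B], keeping only [X :&: (B - e)]. *)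
Lemma olson B X : 0 \in X ->
  translation_closed (sumset B X) X \/ (2 * #|B| + #|X| <= 2 * #|sumset B X|)%N.
Proof.
have [n] := ubnP #|X|; elim: n => // n IHn in B X * => ltXn X0.
case: (boolP [forall e in B, forall x in X, e + x \in B]) => [stab | ].
  have cB b x : b \in B -> x \in X -> b + x \in B.
    by move=> bB xX; move/forall_inP: stab => /(_ b bB) /forall_inP /(_ x xX).
  left=> _ x /imset2P[b y bB yX ->] xX.
  by apply: mem_sumset => //; exact: cB.
case/forall_inPn => e eB /forall_inPn[x0 x0X ex0].
pose X1 := [set x in X | e + x \in B].
pose B1 := B :|: [set e + x | x in X].
have X1X : X1 \subset X by apply/subsetP => x; rewrite inE => /andP[].
have X10 : 0 \in X1 by rewrite inE X0 addr0.
have ltX1 : (#|X1| < #|X|)%N.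
  apply: proper_card; apply/properP; split=> //.
  by exists x0 => //; rewrite inE x0X.
have cardB1 : #|B1| = (#|B| + (#|X| - #|X1|))%N.
  have -> : B1 = B :|: [set e + x | x in X :\: X1].
    apply/setP=> y; rewrite !inE; case: (boolP (y \in B)) => //= yB.
    apply/imsetP/imsetP => -[x xX yE]; exists x => //.
      by rewrite !inE xX -yE (negPf yB).
    by move: xX; rewrite !inE => /andP[].
  rewrite cardsU disjoint_setI0 ?cards0 ?subn0; last first.
    rewrite disjoint_sym disjoints_subset; apply/subsetP => y /imsetP[x xX ->].
    by move: xX; rewrite !inE negb_and => /andP[/orP[/negPf-> //|->]].
  by rewrite card_imset ?cardsD; [rewrite (setIidPr X1X) | apply: addrI].
have subB : sumset B1 X1 \subset sumset B X.
  apply/subsetP => _ /imset2P[b x bB1 xX1 ->].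
  move: (xX1); rewrite inE => /andP[xX exB].
  case/setUP: bB1 => [bB|/imsetP[y yX ->]]; first exact: mem_sumset.
  by rewrite addrAC mem_sumset.
have le1 : (#|B1| <= #|sumset B X|)%N.
  by apply: leq_trans (subset_leq_card subB); apply/subset_leq_card/sumset_subl.
(* The transform keeps [#|B| + #|X|], so if [X1] is at most half of [X], then [B1] alone is large
   enough. *)
have [small|big] := leqP (2 * #|X1|) #|X|; first by right; lia.
have [||stabC|ge1] := IHn B1 X1 => //; first by lia.
  2: { by right; have := subset_leq_card subB; lia. }
pose C := sumset B1 X1.
(* The stabilizer of [C] contains [X1], hence has more than [#|X| / 2] elements. *)
pose H := [set h : G | [set c + h | c in C] == C].
have HC c h : c \in C -> h \in H -> c + h \in C.
  by move=> cC; rewrite inE => /eqP <-; apply: imset_f.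
have XH : X1 \subset H.
  apply/subsetP => x xX1; rewrite inE eqEcard card_translate leqnn andbT.
  by apply/subsetP => _ /imsetP[c cC ->]; apply: stabC.
have BC : B \subset C.
  by apply: (subset_trans _ (sumset_subl B1 X1 X10)); apply: subsetUl.
have HN h : h \in H -> - h \in H.
  rewrite !inE => /eqP hC; apply/eqP; rewrite -{1}hC -imset_comp -[RHS]imset_id.
  by apply: eq_imset => c /=; rewrite addrK.
have HD h k : h \in H -> k \in H -> h + k \in H.
  rewrite !inE => /eqP hC /eqP kC; apply/eqP; rewrite -[RHS]kC -{2}hC -imset_comp.
  by apply: eq_imset => c /=; rewrite addrA.
have BHC : sumset B H \subset C.
  apply/subsetP => _ /imset2P[b h bB hH ->]; apply: HC => //.
  exact: (subsetP BC).
have BH : sumset B H \subset sumset B X := subset_trans BHC subB.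
have H0 : 0 \in H := subsetP XH _ X10.
case: (boolP (sumset B X \subset sumset B H)) => [BX|/subsetPn[y yBX yBH]].
  left=> y x /(subsetP BX) /imset2P[b h bB hH ->] xX; apply: (subsetP BH).
  rewrite addrAC; have /(subsetP BX) /imset2P[b' h' b'B h'H ->] := mem_sumset _ _ _ _ bB xX.
  by rewrite -addrA mem_sumset // HD.
right.
case/imset2P: yBX => b x bB xX yE; rewrite {}yE in yBH.
(* [D] is the part of [B] in the coset [b + H]. Its translate by [x] misses [sumset B H], whereas
   [B] and [b + H] lie in [sumset B H] and meet inside [D]; so [sumset B X] has at least
   [#|B| + #|H|] elements. *)
pose D := [set c in B | c - b \in H].
have le2 : (#|sumset B H| + #|D| <= #|sumset B X|)%N.
  rewrite -(card_translate D x) -cardsUI disjoint_setI0 ?cards0 ?addn0.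
    apply: subset_leq_card; rewrite subUset BH; apply/subsetP => _ /imsetP[c + ->].
    by rewrite inE => /andP[cB _]; apply: mem_sumset.
  rewrite disjoint_sym disjoints_subset; apply/subsetP => _ /imsetP[c + ->].
  rewrite inE => /andP[cB cbH]; rewrite in_setC; apply: contra yBH => /imset2P[b' h b'B hH eq].
  have -> : b + x = b' + (h - (c - b)).
    by rewrite addrA -eq opprB [c + x]addrC addrACA subrr addr0 addrC.
  exact: mem_sumset b'B (HD _ _ hH (HN _ cbH)).
have le3 : (#|B| + #|H| <= #|sumset B H| + #|D|)%N.
  rewrite -(card_imset (mem H) (addrI b)) -(cardsUI B) leq_add //; apply: subset_leq_card.
    rewrite subUset sumset_subl //=; apply/subsetP => _ /imsetP[h hH ->].
    exact: mem_sumset.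
  apply/subsetP => c /setIP[cB /imsetP[h hH ch]]; rewrite inE cB ch.
  by rewrite addrAC subrr add0r.
by move: big le2 le3 (subset_leq_card XH); clear; lia.
Qed.

End Sumset.

(** * Subgroups of the integers modulo [q.+1] *)

Definition residue (q : nat) (t : int) : 'I_q.+1 := (inZp 1 : 'I_q.+1) *~ t.

Lemma residueD q t u : residue q (t + u) = residue q t + residue q u.
Proof. exact: mulrzDr. Qed.

Lemma residueB q t u : residue q (t - u) = residue q t - residue q u.
Proof. exact: mulrzBr. Qed.

Lemma residueM q t u : residue q (t * u) = residue q t *~ u.
Proof. exact: mulrzA. Qed.

Lemma residue_nat q (n : nat) : residue q n = inZp n.
Proof.
rewrite /residue -pmulrn Zp_mulrn; apply: val_inj => /=.
by rewrite modnMml mul1n.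
Qed.

Lemma residue_eq0 q t : (residue q t == 0) = (q.+1 %| t)%Z.
Proof.
have natE (n : nat) : (residue q n == 0) = (q.+1 %| n%:Z)%Z.
  by rewrite residue_nat -val_eqE.
case: t => n; first exact: natE.
rewrite NegzE [RHS]dvdzE abszN -[RHS]/(q.+1 %| n.+1%:Z)%Z.
by rewrite -natE -sub0r residueB [residue q 0]mulr0z sub0r oppr_eq0.
Qed.

Lemma residue_surj q (x : 'I_q.+1) : residue q x = x.
Proof. by rewrite residue_nat valZpK. Qed.

(** Closure under addition already gives opposites, as [- x] is [q] times [x]. The integers with
    class in [H] thus form an ideal, generated by its least positive element [g]; since [q.+1]
    belongs to it, [g] divides [q.+1]. *)
Lemma addr_closed_residues q (H : {set 'I_q.+1}) :
    0 \in H -> (forall x y, x \in H -> y \in H -> x + y \in H) ->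
  exists g : nat, [/\ (0 < g)%N, (g %| q.+1)%N &
    forall t, (residue q t \in H) = (g %| t)%Z].
Proof.
move=> H0 HD.
have HM x (n : nat) : x \in H -> x *+ n \in H.
  by move=> xH; elim: n => [|n IHn]; rewrite ?mulr0n // mulrS HD.
have q0 : residue q q.+1 = 0 by apply/eqP; rewrite residue_eq0 dvdzz.
have HN x : x \in H -> - x \in H.
  rewrite -[x]residue_surj => /(HM _ q).
  suff -> : residue q x *+ q = - residue q x by [].
  apply/eqP; rewrite -subr_eq0 opprK -mulrSr -[_ *+ _]/(_ *~ q.+1) -residueM.
  by rewrite residue_eq0 dvdz_mull.
have exg : exists g : nat, (0 < g)%N && (residue q g \in H) by exists q.+1; rewrite q0.
case: (ex_minnP exg) => g /andP[g0 gH] gmin.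
have gE t : (residue q t \in H) = (g %| t)%Z.
  apply/idP/idP => [tH | /dvdzP[k ->]]; last first.
    rewrite mulrC residueM; case: k => k; first by rewrite -pmulrn HM.
    by rewrite NegzE mulrNz HN // -pmulrn HM.
  have rH : residue q (t %% g)%Z \in H.
    rewrite /modz residueB HD // HN // mulrC residueM.
    case: (t %/ g)%Z => k; first by rewrite -pmulrn HM.
    by rewrite NegzE mulrNz HN // -pmulrn HM.
  have gn0 : (g : int) != 0 by lia.
  have r0 := modz_ge0 t gn0; have ltr := ltz_mod t gn0.
  apply/dvdz_mod0P/eqP; apply: contraT => rn0.
  have := gmin `|(t %% g)%Z|%N; rewrite gez0_abs // rH andbT => /(_ _); lia.
exists g; split=> //.
by have := gE q.+1; rewrite q0 H0 => /esym.
Qed.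

(* [E] together with [0] generates a subgroup of [Z/q] in at most
   [2 q / #|E| + 1] steps by Olson's theorem; copies of [q] then fill in the
   multiples of [g] in a long interval. *)
Lemma long_progression_of_sums (E : seq nat) (q L : nat) :
    uniq E -> (forall x, x \in E -> 0 < x <= q)%N -> q \in E ->
    let l := (2 * q %/ size E).+1 in
  exists g : nat, [/\ (0 < g)%N, (g * size E <= q)%N &
    forall t, (g %| t)%N -> (l * q <= t)%N -> (t <= (L - l) * q)%N ->
      exists s : seq nat, [/\ {subset s <= E}, (size s <= L)%N & sumn s = t]].
Proof.
move=> uE Ele qE l; have /andP[q0 _] := Ele q qE.
case: q q0 Ele qE @l => // q _ Ele qE l.
pose X : {set 'I_q.+1} := [set x in [seq residue q (e : nat) | e <- E]].
have inj : {in E &, injective (fun e : nat => residue q e)}.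
  move=> x y /Ele /andP[x0 xq] /Ele /andP[y0 yq] /eqP.
  rewrite -subr_eq0 -residueB residue_eq0 => /dvdzP[k kE].
  have : k = 0 by nia.
  by move=> k0; move: kE; rewrite k0; lia.
have cardX : #|X| = size E.
  rewrite cardsE -(size_map (fun e : nat => residue q e)).
  by apply/card_uniqP; rewrite map_inj_in_uniq.
have XE (e : nat) : e \in E -> residue q e \in X.
  by move=> eE; rewrite inE; apply: (map_f (fun e : nat => residue q e)).
have X0 : 0 \in X.
  suff <- : residue q q.+1 = 0 by exact: XE.
  by apply/eqP; rewrite residue_eq0 dvdzz.
have E0 : (0 < size E)%N by case: (E) qE.
pose B j := iter j (fun B => sumset _ B X) [set 0].
have Brep j y : y \in B j -> exists s : seq nat,
    [/\ {subset s <= E}, size s = j & residue q (sumn s) = y].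
  elim: j y => [|j IHj] y /=.
    by rewrite inE => /eqP ->; exists [::]; split=> //; rewrite [LHS]mulr0z.
  case/imset2P=> b x /IHj[s [sE sj <-]]; rewrite inE => /mapP[e eE ->] ->.
  exists (e :: s); split; rewrite /= ?sj //.
    by move=> z; rewrite inE => /orP[/eqP ->|/sE].
  by rewrite PoszD residueD addrC.
have Bgrow j : translation_closed _ (B j.+1) X \/
               (2 + j.+1 * size E <= 2 * #|B j.+1|)%N.
  elim: j => [|j [cl|IHj]].
  - rewrite mul1n; have [cl|] := olson _ [set 0] X X0; first by left.
    by rewrite cards1 cardX muln1; right.
  - left=> _ x /imset2P[b y bB yX ->] xX; apply: mem_sumset => //.
    exact: cl.
  - have [cl|] := olson _ (B j.+1) X X0; first by left.
    rewrite cardX => le; right; apply: leq_trans le.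
    by rewrite mulSn addnCA addnC leq_add2r.
(* By the choice of [l], [l * size E] exceeds [2 * q.+1], twice the order of the group, so the
   growth must have stopped. *)
have Bcl : translation_closed _ (B l) X.
  have [//|] := Bgrow (2 * q.+1 %/ size E)%N; rewrite -/l.
  have := max_card (mem (B l)); rewrite card_ord.
  have := divn_eq (2 * q.+1) (size E); have := ltn_pmod (2 * q.+1) E0.
  rewrite /l mulSn; move: (2 * q.+1 %/ size E)%N (2 * q.+1 %% size E)%N #|_| => d r c.
  by clear; lia.
have BD j x y : x \in B l -> y \in B j -> x + y \in B l.
  move=> xB; elim: j y => [|j IHj] y /=; first by rewrite inE => /eqP ->; rewrite addr0.
  by case/imset2P => b z /IHj xb zX ->; rewrite addrA; apply: Bcl.
have B0 : 0 \in B l.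
  elim: (l) => [|j IHj] /=; first by rewrite inE.
  by rewrite -[0]addr0 mem_sumset.
have [g [g0 gq gE]] := addr_closed_residues q (B l) B0 (BD l).
have XB x : x \in X -> x \in B l by move=> xX; rewrite -[x]add0r; apply: Bcl.
exists g; split=> //.
  have gdv e : e \in E -> (g %| e)%N.
    by move=> eE; have := gE e; rewrite XB ?XE // => /esym.
  rewrite mulnC -leq_divRL // -(size_map (fun e => e %/ g)%N) -(size_iota 1 (q.+1 %/ g)).
  apply: uniq_leq_size.
    rewrite map_inj_in_uniq // => x y /gdv gx /gdv gy eq.
    by rewrite -(divnK gx) eq divnK.
  move=> _ /mapP[e eE ->]; have /andP[e0 eq] := Ele e eE.
  rewrite mem_iota add1n ltnS leq_div2r // andbT divn_gt0 //.
  exact: dvdn_leq (gdv e eE).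
move=> t gt lt tL.
have tB : residue q t \in B l by rewrite gE.
have [s [sE sl sres]] := Brep l _ tB.
have les : (sumn s <= l * q.+1)%N.
  rewrite -sl; elim: (s) sE => //= e s' IHs sE.
  rewrite mulSn leq_add ?IHs //; last by move=> z zs; apply: sE; rewrite inE zs orbT.
  by have /andP[] := Ele e (sE e (mem_head _ _)).
(* The sum of [s] is congruent to [t] and at most [l * q.+1]; copies of [q.+1], itself in [E], make
   up the rest, and at most [L - l] of them are needed. *)
have : (q.+1 %| t%:Z - (sumn s)%:Z)%Z by rewrite -residue_eq0 residueB sres subrr.
rewrite subzn ?(leq_trans les) //; move=> /dvdnP[c cE].
exists (s ++ nseq c q.+1); split.
- move=> z; rewrite mem_cat mem_nseq => /orP[/sE //|/andP[_ /eqP ->] //].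
- rewrite size_cat size_nseq sl; have : (c * q.+1 <= (L - l) * q.+1)%N by lia.
  rewrite leq_pmul2r //; have : (l <= L)%N \/ (L < l)%N by lia.
  case; first by lia.
  by move=> Ll; have : (0 < l * q.+1)%N by []; lia.
- rewrite sumn_cat sumn_nseq mulnC -cE; lia.
Qed.

(** * Subset sums of integers *)

Lemma perm_cat_consr (T : eqType) (x : T) s1 s2 :
  perm_eq (s1 ++ x :: s2) (x :: s1 ++ s2).
Proof. by rewrite (perm_catCA s1 [:: x] s2). Qed.

Definition subsum (s : seq int) (y : int) : Prop :=
  exists s1 s2, perm_eq s (s1 ++ s2) /\ y = \sum_(x <- s1) x.

Lemma subsum_nil : subsum [::] 0.
Proof. by exists [::], [::]; rewrite big_nil. Qed.

Lemma subsum_consl a s y : subsum s y -> subsum (a :: s) y.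
Proof.
case=> s1 [s2 [sE ->]]; exists s1, (a :: s2); split=> //.
by rewrite perm_sym (permPl (perm_cat_consr _ _ _ _)) perm_cons perm_sym.
Qed.

Lemma subsum_consr a s y : subsum s y -> subsum (a :: s) (a + y).
Proof.
by case=> s1 [s2 [sE ->]]; exists (a :: s1), s2; rewrite big_cons /= perm_cons.
Qed.

Lemma subsum_norm s (M : nat) y :
  (forall x, x \in s -> `|x| <= M%:Z) -> subsum s y -> `|y| <= (size s * M)%N%:Z.
Proof.
move=> sM [s1 [s2 [sE ->]]].
have : (size s1 <= size s)%N by rewrite (perm_size sE) size_cat leq_addr.
have : forall x, x \in s1 -> `|x| <= M%:Z.
  by move=> x xs; apply: sM; rewrite (perm_mem sE) mem_cat xs.
elim: s1 {sE} (size s) => [|a s1 IHs] k s1M /=; first by rewrite big_nil normr0.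
case: k => // k lek; rewrite big_cons mulSn PoszD.
apply: le_trans (ler_normD _ _) _; apply: lerD; first by apply: s1M; rewrite mem_head.
by apply: IHs => // x xs; apply: s1M; rewrite inE xs orbT.
Qed.

(** An element of absolute value at most [W] moves an interval of length at least [W] to one that
    meets it, so the union is again an interval. Positive elements extend it to the right, negative
    ones to the left, and [N] is the total absolute value of the latter. *)
Lemma extend_interval (U : seq int) (W : int) :
    0 <= W -> (forall u, u \in U -> `|u| <= W) ->
  exists N : int, forall c t, c - N <= t <= c + W + (\sum_(u <- U) `|u| - N) ->
    exists y, subsum U y /\ c <= t - y <= c + W.
Proof.
move=> W0 UW.
suff [N [_ NP]] : exists N : int, 0 <= N <= \sum_(u <- U) `|u| /\
    forall c t, c - N <= t <= c + W + (\sum_(u <- U) `|u| - N) ->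
    exists y, subsum U y /\ c <= t - y <= c + W by exists N.
elim: U UW => [|u U IHU] UW.
  exists 0; rewrite big_nil; split=> // c t ct.
  by exists 0; split; [exact: subsum_nil | lia].
have [|N [Nge NP]] := IHU; first by move=> v vU; apply: UW; rewrite inE vU orbT.
have uW : `|u| <= W by apply: UW; rewrite mem_head.
rewrite big_cons; set S := \sum_(_ <- U) _ in Nge NP *.
have [u0|u0] := leP 0 u.
  exists N; split=> [|c t ct]; first lia.
  have [le|gt] := leP t (c + W + (S - N)).
    by have [|y [sy cy]] := NP c t; [lia | exists y; split=> //; apply: subsum_consl].
  have [|y [sy cy]] := NP c (t - u); first lia.
  by exists (u + y); split; [exact: subsum_consr | lia].
exists (N + `|u|); split=> [|c t ct]; first lia.
have [le|gt] := leP (c - N) t.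
  by have [|y [sy cy]] := NP c t; [lia | exists y; split=> //; apply: subsum_consl].
have [|y [sy cy]] := NP c (t - u); first lia.
by exists (u + y); split; [exact: subsum_consr | lia].
Qed.

Fixpoint residue_sums q (T : seq int) : {set 'I_q.+1} :=
  if T is a :: T' then
    residue_sums q T' :|: [set residue q a + x | x in residue_sums q T']
  else [set 0].

Lemma residue_sums0 q T : 0 \in residue_sums q T.
Proof. by elim: T => [|a T IHT] /=; rewrite inE // IHT. Qed.

Lemma residue_sumsP q T x :
  x \in residue_sums q T -> exists y, subsum T y /\ residue q y = x.
Proof.
elim: T x => [|a T IHT] x /=.
  by rewrite inE => /eqP ->; exists 0; split; [exact: subsum_nil | exact: mulr0z].
case/setUP => [/IHT[y [Ty yx]]|/imsetP[z /IHT[y [Ty yz]] ->]].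
  by exists y; split=> //; apply: subsum_consl.
by exists (a + y); rewrite residueD yz; split=> //; apply: subsum_consr.
Qed.

(* Move elements from [U] to [T] as long as this enlarges the set of subset
   sums of [T] modulo [q + 1]; the elements left in [U] are then periods of
   that set. *)
Lemma cover_residues (R : seq int) (q : nat) :
  exists T U (g : nat), [/\ perm_eq R (T ++ U), (size T <= q)%N,
    (0 < g <= q.+1)%N, (forall u, u \in U -> (g %| u)%Z) &
    forall t, (g %| t)%Z -> exists y, subsum T y /\ (q.+1 %| t - y)%Z].
Proof.
(* [k] bounds the enlargements still possible. Each move adds one element to [T] and at least one
   residue, so [T] stays smaller than its set of sums, which has at most [q.+1] elements. *)
suff loop k T U : (#|residue_sums q T| + k >= q.+1)%N ->
    (size T < #|residue_sums q T|)%N -> perm_eq R (T ++ U) ->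
    exists T U, [/\ perm_eq R (T ++ U), (size T <= q)%N &
      forall u x, u \in U -> x \in residue_sums q T ->
        residue q u + x \in residue_sums q T].
  have [||//|T [U [RTU szT stab]]] := loop q.+1 [::] R.
  - exact: leq_addl.
  - by rewrite cards1.
  pose S := residue_sums q T.
  pose H := [set h : 'I_q.+1 | [set h + x | x in S] == S].
  have HS h x : h \in H -> x \in S -> h + x \in S.
    by rewrite inE => /eqP hS xS; rewrite -hS; apply: imset_f.
  have [||g [g0 gq gE]] := addr_closed_residues q H.
  - by rewrite inE -[X in _ == X]imset_id; apply/eqP/eq_imset => x; rewrite add0r.
  - move=> h k; rewrite !inE => /eqP hS /eqP kS; rewrite -[X in _ == X]hS -{2}kS.
    by rewrite -imset_comp; apply/eqP/eq_imset => x /=; rewrite addrA.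
  exists T, U, g; split=> // [|u uU|t].
  - by rewrite g0 dvdn_leq.
  - rewrite -gE inE eqEcard card_imset ?leqnn ?andbT; last exact: addrI.
    by apply/subsetP => _ /imsetP[x xS ->]; apply: stab.
  rewrite -gE => /HS/(_ (residue_sums0 q T)); rewrite addr0 => /residue_sumsP[y [Ty yt]].
  by exists y; rewrite -residue_eq0 residueB yt subrr.
have card_le V : (#|residue_sums q V| <= q.+1)%N.
  by apply: leq_trans (max_card _) _; rewrite card_ord.
elim: k T U => [|k IHk] T U leS szT RTU.
  exists T, U; split=> //; first by rewrite -ltnS (leq_trans szT).
  move=> u x _ _; suff -> : residue_sums q T = [set: 'I_q.+1] by rewrite inE.
  by apply/eqP; rewrite eqEcard subsetT cardsT card_ord -[#|_|]addn0.
case: (boolP (all (fun u => [set residue q u + x | x in residue_sums q T]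
                              \subset residue_sums q T) U)).
  move=> /allP stab; exists T, U; split=> //; first by rewrite -ltnS (leq_trans szT).
  by move=> u x /stab /subsetP sub xS; apply: sub; apply: imset_f.
case/allPn => u uU nsub.
have lt : (#|residue_sums q T| < #|residue_sums q (u :: T)|)%N.
  apply: proper_card; rewrite properE subsetUl /=.
  by apply: contra nsub; apply: subset_trans; apply: subsetUr.
apply: (IHk (u :: T) (rem u U)).
- by apply: leq_trans leS _; rewrite addnS -addSn leq_add2r.
- by apply: leq_trans lt.
rewrite (permPl RTU) cat_cons -(permPr (perm_cat_consr _ u T _)).
by rewrite perm_cat2l perm_to_rem.
Qed.

(** * Differences with many representations *)

Definition diff_reps (A1 A2 : seq int) (d : int) : nat :=
  (\sum_(x <- A1) count_mem (x + d)%R A2)%N.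

(** The differences are realized greedily, each by a fresh pair. A used element occurs in at most
    [m] representations of a given [d], so the earlier choices spoil fewer than [2 * m * size ds] of
    them. *)
Lemma realize_differences (A1 A2 ds : seq int) (m : nat) :
    (0 < m)%N ->
    (forall v, count_mem v A1 <= m)%N -> (forall v, count_mem v A2 <= m)%N ->
    (forall d, d \in ds -> 2 * m * size ds <= diff_reps A1 A2 d)%N ->
  exists B1 C1 B2 C2, [/\ perm_eq A1 (B1 ++ C1), perm_eq A2 (B2 ++ C2),
    size B1 = size ds, size B2 = size ds &
    \sum_(x <- B2) x - \sum_(x <- B1) x = \sum_(d <- ds) d].
Proof.
move=> m0 m1 m2; elim: ds => [|d ds IHds] reps.
  by exists [::], A1, [::], A2; rewrite !big_nil subrr.
have [|B1 [C1 [B2 [C2 [AE1 AE2 s1 s2 sumE]]]]] := IHds.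
  move=> e eds; apply: leq_trans (reps e _); last by rewrite inE eds orbT.
  by rewrite leq_mul2l leqnSn orbT.
have [/hasP[x xC1 xC2]|/hasPn none] := boolP (has (fun x => x + d \in C2) C1).
  exists (x :: B1), (rem x C1), (x + d :: B2), (rem (x + d) C2); split=> /=.
  - rewrite (permPl AE1) -(permPr (perm_cat_consr _ x B1 _)) perm_cat2l.
    exact: perm_to_rem.
  - rewrite (permPl AE2) -(permPr (perm_cat_consr _ (x + d) B2 _)) perm_cat2l.
    exact: perm_to_rem.
  - by rewrite s1.
  - by rewrite s2.
  - by rewrite !big_cons -sumE opprD addrACA [x + d]addrC addrK.
(* Otherwise every representation of [d] starts in [B1] or ends in [B2]. *)
have := reps d (mem_head _ _); rewrite leqNgt => /negP[].
rewrite /diff_reps (perm_big _ AE1) big_cat /=.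
have le1 : (\sum_(x <- B1) count_mem (x + d)%R A2 <= size ds * m)%N.
  rewrite -s1; elim: (B1) => [|b B IHB]; first by rewrite big_nil.
  by rewrite big_cons /= mulSn leq_add.
have le2 : (\sum_(x <- C1) count_mem (x + d)%R A2 <= size ds * m)%N.
  have -> : (\sum_(x <- C1) count_mem (x + d)%R A2 =
             \sum_(y <- B2) count_mem (y - d)%R C1)%N.
    transitivity (\sum_(x <- C1) \sum_(y <- B2) (y == (x + d)%R))%N.
      rewrite [LHS]big_seq [RHS]big_seq; apply: eq_bigr => x xC1.
      rewrite (permP AE2) count_cat (count_memPn (none x xC1)) addn0.
      by rewrite -sum1_count big_mkcond.
    rewrite exchange_big; apply: eq_bigr => y _.
    rewrite -sum1_count [RHS]big_mkcond; apply: eq_bigr => x _ /=.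
    by rewrite [in RHS]eq_sym subr_eq.
  rewrite -s2; elim: (B2) => [|b B IHB]; first by rewrite big_nil.
  rewrite big_cons /= mulSn leq_add // (leq_trans _ (m1 (b - d))) //.
  by rewrite (permP AE1) count_cat leq_addl.
by apply: leq_ltn_trans (leq_add le1 le2) _; rewrite /=; nia.
Qed.

Lemma sum_diff_reps (A1 A2 : seq int) (D : nat) :
    (forall x y, x \in A1 -> y \in A2 -> 0 < y - x <= D%:Z) ->
  (\sum_(d <- iota 1 D) diff_reps A1 A2 d%:Z = size A1 * size A2)%N.
Proof.
move=> dif; rewrite /diff_reps exchange_big /=.
transitivity (\sum_(x <- A1) size A2)%N; last first.
  by elim: (A1) => [|a A IHA]; rewrite ?big_nil // big_cons IHA /= mulSn.
rewrite [LHS]big_seq [RHS]big_seq; apply: eq_bigr => x xA.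
under eq_bigr do rewrite -sum1_count big_mkcond /=.
rewrite exchange_big /= -sum1_size [LHS]big_seq [RHS]big_seq; apply: eq_bigr => y yA.
have /andP[d0 dD] := dif x y xA yA.
rewrite (bigD1_seq `|(y - x)%R|%N) /= ?iota_uniq //; last first.
  by rewrite mem_iota; lia.
have -> : y == x + `|y - x|%N%:Z by lia.
by rewrite big1 // => d dn; case: ifP => // /eqP yE; case/eqP: dn; lia.
Qed.

(** If [2 ^ i <= r d < 2 ^ i.+1], the powers [2 ^ j] up to [r d] sum to [2 ^ i.+1 - 1], which is at
    least [r d]. Summing over [d], one of the [k] levels carries a [k]-th of the total. *)
Lemma dyadic_pigeonhole (r : nat -> nat) (s : seq nat) (k : nat) :
    (forall d, d \in s -> r d < 2 ^ k)%N -> (0 < \sum_(d <- s) r d)%N ->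
  exists j, (\sum_(d <- s) r d <=
    k * (2 ^ j * size [seq d <- s | 2 ^ j <= r d]))%N.
Proof.
move=> rk S0; set S := (\sum_(_ <- _) _)%N in S0 *.
pose a j := (2 ^ j * size [seq d <- s | 2 ^ j <= r d])%N.
suff [j le] : exists j : 'I_k, (S <= k * a j)%N by exists j.
apply/existsP; apply: contraT => /existsPn small.
have SE : (S <= \sum_(j < k) a j)%N.
  have -> : (\sum_(j < k) a j = \sum_(d <- s) \sum_(j < k) (2 ^ j <= r d) * 2 ^ j)%N.
    rewrite exchange_big; apply: eq_bigr => j _; rewrite /a size_filter -sum1_count.
    rewrite big_distrr /= [LHS]big_mkcond; apply: eq_bigr => d _ /=.
    by rewrite muln1; case: ifP; rewrite ?mul1n.
  rewrite /S !big_seq; apply: leq_sum => d ds.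
  have := rk d ds; elim: (k) => [|i IHi]; first by rewrite ltnS leqn0 => /eqP ->.
  rewrite big_ord_recr /= => lt; case: (leqP (2 ^ i) (r d)) => [ge|/IHi]; last first.
    by rewrite mul0n addn0.
  rewrite mul1n; have : (2 ^ i <= (\sum_(j < i) (2 ^ j <= r d) * 2 ^ j).+1)%N.
    have -> : (\sum_(j < i) (2 ^ j <= r d) * 2 ^ j = \sum_(j < i) 2 ^ j)%N.
      apply: eq_bigr => j _; rewrite (leq_trans _ ge) ?mul1n //.
      by rewrite leq_exp2l // ltnW.
    elim: (i) => [|i' IHi']; first by rewrite big_ord0.
    by rewrite big_ord_recr /= expnS mul2n -addnn -addSn leq_add2r.
  by move=> le; rewrite -ltnS (leq_trans lt) // expnS mul2n -addnn -addSn leq_add2r.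
case: (posnP k) SE small => [-> |k0 SE small]; first by rewrite big_ord0; lia.
have : (k * \sum_(j < k) a j <= \sum_(j < k) S.-1)%N.
  by rewrite big_distrr /=; apply: leq_sum => j _; have := small j; lia.
by rewrite sum_nat_const card_ord leq_pmul2l //; lia.
Qed.

(** The Chinese remainder theorem determines [t] modulo [g * p], so every interval of that length
    contains a solution. *)
Lemma crt_interval (g p : nat) (c tau : int) :
    (0 < g)%N -> (0 < p)%N -> coprime g p ->
  exists t : int, [/\ (g %| t)%Z, (p %| t - tau)%Z & c <= t < c + (g * p)%N%:Z].
Proof.
move=> g0 p0 co; have co' : coprimez g p by rewrite /coprimez /gcdz !absz_nat.
pose t0 := zchinese g p 0 tau; pose P : int := (g * p)%N%:Z.
have PE : P = g%:Z * p%:Z by rewrite /P PoszM.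
have P0 : 0 < P by rewrite /P ltz_nat muln_gt0 g0.
have [k tE] : exists k : int, c + ((t0 - c) %% P)%Z = t0 + k * P.
  exists (- ((t0 - c) %/ P)%Z); rewrite /modz.
  by rewrite mulNr addrA [c + _]addrC subrK.
exists (c + ((t0 - c) %% P)%Z); split.
- rewrite tE rpredDr; last by rewrite PE mulrCA dvdz_mulr.
  by have /eqP := zchinese_modl co' 0 tau; rewrite eqz_mod_dvd subr0.
- rewrite tE addrAC rpredDr; last by rewrite PE mulrA dvdz_mull.
  by have /eqP := zchinese_modr co' 0 tau; rewrite eqz_mod_dvd.
have := modz_ge0 (t0 - c) (lt0r_neq0 P0); have := ltz_pmod (t0 - c) P0.
by rewrite -/P; move: (_ %% _)%Z => x; lia.
Qed.

Lemma dvdz_subsum (g : nat) (U : seq int) (y : int) :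
  (forall u, u \in U -> (g %| u)%Z) -> subsum U y -> (g %| y)%Z.
Proof.
move=> gU [s1 [s2 [UE ->]]]; rewrite big_seq.
apply: (big_ind (fun x => (g %| x)%Z)) => [|x y' gx gy|u us]; first exact: dvdz0.
  exact: rpredD.
by apply: gU; rewrite (perm_mem UE) mem_cat us.
Qed.

Lemma diff_reps_le (A1 A2 : seq int) (m : nat) d :
  (forall v, count_mem v A2 <= m)%N -> (diff_reps A1 A2 d <= size A1 * m)%N.
Proof.
move=> m2; rewrite /diff_reps; elim: A1 => [|a A IHA]; first by rewrite big_nil.
by rewrite big_cons /= mulSn leq_add.
Qed.

(** If the sum over [U] reached [g * p], then, up to the sum of [A1], the subset sums would contain
    all multiples of [g] in an interval of length [g * p], and [crt_interval] would find [tau]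
    modulo [p] among them. *)
Lemma incomplete_spread (p n m M k : nat) (A1 R A2 : seq int) (tau : int) :
    prime p -> (0 < m)%N -> (0 < n)%N -> (n * n < 2 ^ k)%N ->
    (34 * (m * M) * k <= n * n)%N ->
    (forall x, x \in A1 ++ R ++ A2 -> `|x| <= M%:Z) ->
    (forall v, count_mem v (A1 ++ R ++ A2) <= m)%N ->
    size A1 = n -> size A2 = n ->
    (forall x y, x \in A1 -> y \in A2 -> 0 < y - x < p%:Z) ->
    (forall s1 s2, perm_eq (A1 ++ R ++ A2) (s1 ++ s2) -> s1 != [::] ->
       ~~ (p %| (\sum_(x <- s1) x - tau)%R)%Z) ->
  exists T U (g : nat), [/\ perm_eq R (T ++ U), (size T <= n)%N, (0 < g < p)%N,
    (forall u, u \in U -> (g %| u)%Z) & \sum_(u <- U) `|u| < (g * p)%N%:Z].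
Proof.
move=> p_pr m0 n0 nk big zM zm sA1 sA2 dif inc.
have p0 := prime_gt0 p_pr.
have m1 v : (count_mem v A1 <= m)%N.
  by apply: leq_trans (zm v); rewrite count_cat leq_addr.
have m2 v : (count_mem v A2 <= m)%N.
  by apply: leq_trans (zm v); rewrite !count_cat addnA leq_addl.
have k0 : (0 < k)%N by case: (k) nk => //; nia.
(* Differences are at most [2 * M] by the size bound; the cap [p.-1] will give [g' < p]. *)
pose D := minn (2 * M) p.-1.
pose r d := diff_reps A1 A2 (d : nat)%:Z.
have sumr : (\sum_(d <- iota 1 D) r d = n * n)%N.
  rewrite sum_diff_reps ?sA1 ?sA2 // => x y xA yA.
  have := dif x y xA yA.
  have : `|x| <= M%:Z by apply: zM; rewrite mem_cat xA.
  have : `|y| <= M%:Z by apply: zM; rewrite !mem_cat yA !orbT.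
  by rewrite /D; lia.
have rk d : (r d < 2 ^ k)%N.
  apply: leq_ltn_trans nk; rewrite -{1}sA1 /r; apply: diff_reps_le => v.
  by rewrite -sA2 count_size.
have [||j] := dyadic_pigeonhole r (iota 1 D) k; first by move=> d _; apply: rk.
  by rewrite sumr muln_gt0 n0.
rewrite sumr; set E := [seq d <- _ | _]; set rho := (2 ^ j)%N => jP.
pose e := size E; rewrite -/e in jP.
have e0 : (0 < e)%N by case: e jP => //; rewrite !muln0; nia.
have Erho d : d \in E -> (rho <= r d)%N by rewrite mem_filter => /andP[].
have ED d : d \in E -> (0 < d <= D)%N.
  by rewrite mem_filter mem_iota add1n ltnS => /andP[_].
have [q qE qmax] : exists2 q, q \in E & forall d, d \in E -> (d <= q)%N.
  have exE : exists q, q \in E.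
    by rewrite /e in e0; case: (E) e0 => // x s _; exists x; rewrite mem_head.
  case: (ex_maxnP exE (m := D)) => [d /ED /andP[] //|q qE qmax].
  by exists q.
have qD : (q <= D)%N by have /andP[] := ED q qE.
have qM : (q <= 2 * M)%N by apply: leq_trans qD _; apply: geq_minl.
have qp : (q < p)%N.
  by rewrite -(prednK p0) ltnS; apply: leq_trans qD _; apply: geq_minr.
(* [L] differences from [E] can be realized together because [2 * m * L <= rho]; [l] of them are
   spent on reaching the right residue modulo [q]. *)
pose L := (rho %/ (2 * m))%N; pose l := (2 * q %/ e).+1.
have [|d dE|g [g0 geq prog]] := long_progression_of_sums E q L _ _ qE.
- by rewrite filter_uniq // iota_uniq.
- by have /andP[-> _] := ED d dE; rewrite qmax.
rewrite -/e -/l in geq prog.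
have rhoL : (rho < (L.+1) * (2 * m))%N by rewrite ltn_ceil // muln_gt0.
have Lrho : (L * (2 * m) <= rho)%N by rewrite leq_trunc_div.
have Ln : (2 * L <= n)%N.
  have : (rho <= n * m)%N.
    by apply: leq_trans (Erho q qE) _; rewrite -sA1; apply: diff_reps_le.
  move=> le; have : (L * (2 * m) <= n * m)%N := leq_trans Lrho le.
  by rewrite mulnA leq_pmul2r // mulnC.
(* The hypothesis with 34, [n * n <= k * rho * e] and [rho < 2 * m * L.+1] are combined. The
   inequalities up to [le4] then follow from [e <= q <= 2 * M] and [g * e <= q], mostly after
   multiplication by [e]. *)
have le1 : (17 * M < L.+1 * e)%N.
  have : (34 * (m * M) * k <= (rho * e) * k)%N.
    by apply: leq_trans big _; rewrite [leqRHS]mulnC.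
  rewrite leq_pmul2r // => le.
  have : (34 * (m * M) < L.+1 * (2 * m) * e)%N.
    by apply: leq_ltn_trans le _; rewrite ltn_pmul2r.
  have -> : (34 * (m * M) = 2 * m * (17 * M))%N by nia.
  have -> : (L.+1 * (2 * m) * e = 2 * m * (L.+1 * e))%N by nia.
  by rewrite ltn_pmul2l // muln_gt0.
have eq : (e <= q)%N by apply: leq_trans geq; rewrite leq_pmull.
have le2 : (l * e <= 6 * M)%N.
  have : (2 * q %/ e * e <= 2 * q)%N := leq_trunc_div _ _.
  by rewrite /l mulSn; move: (_ * e)%N => x; clear -qM eq; lia.
have le3 : (15 * M < L * e)%N by move: le1; rewrite mulSn; clear -qM eq; lia.
have gL : (g < L)%N.
  by rewrite -(ltn_pmul2r e0); apply: leq_ltn_trans le3; clear -geq qM; lia.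
have lL : (2 * l <= L)%N by rewrite -(leq_pmul2r e0); clear -le2 le3; lia.
have le4 : (3 * (g * M) <= (L - 2 * l) * q)%N.
  have : ((L - 2 * l) * (g * e) <= (L - 2 * l) * q)%N by rewrite leq_mul2l geq orbT.
  apply: leq_trans.
  have -> : ((L - 2 * l) * (g * e) = g * ((L - 2 * l) * e))%N by rewrite mulnCA.
  have -> : (3 * (g * M) = g * (3 * M))%N by rewrite mulnCA.
  rewrite leq_pmul2l // mulnBl -mulnA; clear -le2 le3; lia.
case: g g0 geq prog gL le4 => // g _ geq prog gL le4.
have [T [U [g' [RTU szT /andP[g'0 g'g] g'U cover]]]] := cover_residues R g.
have g'p : (g' < p)%N.
  apply: leq_ltn_trans qp; apply: leq_trans g'g _; apply: leq_trans geq.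
  by rewrite leq_pmulr.
exists T, U, g'; split=> //; first by clear -szT gL Ln; lia.
  by rewrite g'0.
rewrite ltNge; apply/negP => Uge.
have RM x : x \in R -> `|x| <= M%:Z by move=> xR; apply: zM; rewrite !mem_cat xR orbT.
have TM x : x \in T -> `|x| <= M%:Z.
  by move=> xT; apply: RM; rewrite (perm_mem RTU) mem_cat xT.
(* The progression covers the multiples of [g.+1] from [l * q] to [(L - l) * q]. A margin of
   [g.+1 * M] at either end makes room for the sum [yT] of at most [g] elements; the rest, of length
   [W] from [c] on, is still at least [M] long, as [extend_interval] needs. *)
pose W : int := ((L - 2 * l) * q)%N%:Z - (2 * (g.+1 * M))%N%:Z.
have WM : M%:Z <= W.
  have : (M <= g.+1 * M)%N by rewrite leq_pmull.
  by rewrite /W; clear -le4; lia.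
have [||N NP] := extend_interval U W; first by apply: le_trans WM.
  move=> u uU; apply: le_trans (RM u _) WM.
  by rewrite (perm_mem RTU) mem_cat uU orbT.
pose c : int := (l * q + g.+1 * M)%N%:Z.
have [|t [g't pt ct]] := crt_interval g' p (c - N) (tau - \sum_(x <- A1) x) g'0 p0.
  by rewrite coprime_sym prime_coprime // gtnNdvd.
have [|yU [UyU cyU]] := NP c t.
  have W0 : 0 <= W by apply: le_trans WM.
  by move: ct Uge W0; move: (\sum_(u <- U) _) => S; clear; lia.
have [|yT [TyT gyT]] := cover (t - yU).
  by rewrite rpredB // (dvdz_subsum _ U).
have yTM : `|yT| <= (g.+1 * M)%N%:Z.
  apply: le_trans (subsum_norm _ _ _ TM TyT) _.
  by rewrite lez_nat leq_mul2r leqW ?orbT.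
pose t2 := t - yU - yT.
have t2c : (l * q)%N%:Z <= t2 <= ((L - l) * q)%N%:Z.
  have -> : ((L - l) * q)%N%:Z = ((L - 2 * l) * q)%N%:Z + (l * q)%N%:Z.
    by rewrite -PoszD -mulnDl; congr (Posz (_ * _)); clear -lL; lia.
  by move: cyU yTM; rewrite /t2 /c /W; clear; lia.
have [|||s [sE sL sumE]] := prog `|t2|%N.
- by move: gyT; rewrite -/t2 dvdzE absz_nat.
- by clear -t2c; lia.
- by clear -t2c; lia.
have t20 : 0 <= t2 by clear -t2c; lia.
have [|B1 [C1 [B2 [C2 [AE1 AE2 sB1 sB2 BE]]]]] :=
    realize_differences A1 A2 [seq (d : nat)%:Z | d <- s] m m0 m1 m2.
  move=> _ /mapP[d ds ->]; rewrite size_map; apply: leq_trans (Erho d (sE d ds)).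
  apply: leq_trans Lrho; rewrite mulnC leq_mul2r; apply/orP; right; exact: sL.
have [T1 [T2 [TE yTE]]] := TyT; have [U1 [U2 [UE yUE]]] := UyU.
have sumd : \sum_(d <- [seq (d : nat)%:Z | d <- s]) d = t2.
  rewrite big_map -[RHS]gez0_abs // -sumE sumnE.
  by elim: (s) => [|d s' IHs]; rewrite ?big_nil // !big_cons IHs PoszD.
(* Starting from all of [A1], the exchange of [B1] for [B2] adds the chosen differences and keeps
   [n] elements, so the selection is nonempty. *)
have := inc (C1 ++ B2 ++ T1 ++ U1) (B1 ++ C2 ++ T2 ++ U2).
case/(_ _ _)/negP.
- apply: (@perm_trans _ ((B1 ++ C1) ++ ((T1 ++ T2) ++ (U1 ++ U2)) ++ (B2 ++ C2))).
    apply: perm_cat => //; apply: perm_cat => //.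
    by rewrite (permPl RTU); apply: perm_cat.
  apply/permP => P; rewrite !count_cat; clear; lia.
- rewrite -size_eq0 !size_cat sB2.
  have : (size B1 + size C1 = n)%N by rewrite -size_cat -(perm_size AE1).
  by rewrite sB1; clear -n0; lia.
suff -> : \sum_(x <- C1 ++ B2 ++ T1 ++ U1) x = \sum_(x <- A1) x + t.
  by move: pt; rewrite opprB addrA [t + _]addrC.
rewrite !big_cat /= (perm_big _ AE1) big_cat /= -yTE -yUE.
have -> : t = t2 + yT + yU by rewrite /t2 !subrK.
rewrite -sumd -BE; move: (\sum_(i <- B1) _) (\sum_(i <- B2) _) (\sum_(i <- C1) _).
by clear; lia.
Qed.

(** After sorting, the [n] smallest and the [n] largest elements serve as [A1] and [A2]. Either they
    are strictly separated and [incomplete_spread] applies, or all elements between them equal one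
    value [x], and [g] is essentially [|x|]. *)
Lemma incomplete_integers (p n m M k : nat) (z : seq int) (tau : int) :
    prime p -> (0 < m <= p)%N -> (0 < n)%N -> (n * n < 2 ^ k)%N ->
    (34 * (m * M) * k <= n * n)%N ->
    (forall x, x \in z -> `|x| <= M%:Z) ->
    (forall x, x \in z -> 2 * `|x| < p%:Z) ->
    (forall v, count_mem v z <= m)%N ->
    (forall s1 s2, perm_eq z (s1 ++ s2) -> s1 != [::] ->
       ~~ (p %| (\sum_(x <- s1) x - tau)%R)%Z) ->
  exists zb zr (g : nat), [/\ perm_eq z (zb ++ zr), (size zb <= 3 * n)%N,
    (0 < g < p)%N, (forall u, u \in zr -> (g %| u)%Z) &
    \sum_(u <- zr) `|u| < (g * p)%N%:Z].
Proof.
move=> p_pr /andP[m0 mp] n0 nk big zM zp zm inc; have p1 := prime_gt1 p_pr.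
have [small|large] := leqP (size z) (2 * n).
  exists z, [::], 1%N; split; rewrite ?cats0 ?big_nil ?mul1n ?p1 ?ltz_nat ?(ltnW p1) //.
  by apply: leq_trans small _; rewrite leq_mul2r orbT.
pose zs := sort <=%R z; have zzs : perm_eq z zs by rewrite perm_sym perm_sort.
pose A1 := take n zs; pose R := take (size z - 2 * n) (drop n zs).
pose A2 := drop (size z - 2 * n) (drop n zs).
have zsE : zs = A1 ++ R ++ A2 by rewrite !cat_take_drop.
have szs : size zs = size z by rewrite size_sort.
have sA1 : size A1 = n by rewrite size_takel // szs; lia.
have sA2 : size A2 = n by rewrite !size_drop szs; lia.
have sR : size R = (size z - 2 * n)%N by rewrite size_takel // size_drop szs; lia.
have : pairwise <=%R zs by rewrite -(sorted_pairwise le_trans) sort_le_sorted.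
rewrite zsE !pairwise_cat allrel_catr.
move=> /and3P[/andP[leA1R leA1A2] _ /and3P[leRA2 _ _]].
rewrite zsE in zzs.
have [dif|/allPn[x xA1 /allPn[y yA2 yx]]] := boolP
    (all (fun x => all (fun y => x < y) A2) A1).
  have [||||T [U [g [RTU szT gp gU Ulow]]]] :=
      incomplete_spread p n m M k A1 R A2 tau p_pr m0 n0 nk big _ _ sA1 sA2.
  - by move=> x; rewrite -(perm_mem zzs); apply: zM.
  - by move=> v; rewrite -(permP zzs).
  - move=> x y xA yA; have /allP/(_ y yA) := allP dif x xA.
    have := zp x; have := zp y; rewrite !(perm_mem zzs) !mem_cat xA yA !orbT.
    by move=> /(_ isT) + /(_ isT); lia.
  - by move=> s1 s2; rewrite -(permPl zzs); apply: inc.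
  exists (A1 ++ A2 ++ T), U, g; split=> //; last first.
    by rewrite !size_cat sA1 sA2; clear -szT; lia.
  by rewrite (permPl zzs) -!catA perm_cat2l perm_catC perm_cat2l.
have xy : x = y by apply/eqP; rewrite eq_le (allrelP leA1A2) // leNgt.
have RE : R = nseq (size R) x.
  apply/all_pred1P/allP => r rR /=; rewrite eq_le (allrelP leA1R x r) // andbT.
  by rewrite xy (allrelP leRA2 r y).
have szR : (size R < p)%N.
  apply: leq_trans mp; apply: leq_trans (zm x).
  have cR : count_mem x R = size R by rewrite {1}RE count_nseq /= eqxx mul1n.
  rewrite (permP zzs) !count_cat cR addnCA -[X in (X < _)%N]addn0 ltn_add2l.
  by rewrite ltn_addr // -has_count has_pred1.
(* [maxn] covers [x = 0], where [g] must still be positive. *)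
exists (A1 ++ A2), R, (maxn 1 `|x|%N); split.
- by rewrite (permPl zzs) -!catA perm_cat2l perm_catC.
- by rewrite size_cat sA1 sA2; clear; lia.
- by have := zp x; rewrite (perm_mem zzs) mem_cat xA1 => /(_ isT); lia.
- move=> u; rewrite RE mem_nseq => /andP[_ /eqP ->].
  have [->|x0] := eqVneq x 0; first exact: dvdz0.
  by have -> : maxn 1 `|x|%N = `|x|%N by [lia|]; rewrite dvdzE absz_nat.
have -> : \sum_(u <- R) `|u| = (size R * `|x|)%N%:Z.
  rewrite RE big_nseq size_nseq; elim: (size R) => [|i IHi] //=.
  by rewrite IHi mulSn PoszD; lia.
have : (size R * `|x| <= size R * maxn 1 `|x|)%N by rewrite leq_mul2l leq_maxr orbT.
have : (size R * maxn 1 `|x| < p * maxn 1 `|x|)%N by rewrite ltn_pmul2r // leq_maxl.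
by rewrite ltz_nat [X in (_ < X)%N -> _]mulnC => lt le; apply: leq_ltn_trans lt.
Qed.

(** * The Fourier argument *)

From mathcomp Require Import ring lra finmap multiset.
From mathcomp Require Import all_classical all_reals all_analysis.
Import Order.TTheory GRing.Theory Num.Theory.

Lemma Fp_lt (p : nat) (x : 'F_p) : prime p -> (x < p)%N.
Proof. by move=> p_pr; rewrite -{2}(Fp_cast p_pr). Qed.

Lemma dist0_le (p : nat) (x : 'F_p) : prime p -> (2 * dist0 x <= p)%N.
Proof. by move=> /(Fp_lt p x); rewrite /dist0; lia. Qed.

(** Signs replace membership in a subset: the Fourier transform of this count is then a real product
    of cosines. *)
Fixpoint sign_count (p : nat) (s : seq 'F_p) (t : 'F_p) : nat :=
  if s is a :: s' then (sign_count p s' (t - a)%R + sign_count p s' (t + a)%R)%N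
  else (t == 0).

Lemma sign_count_gt0 (p : nat) (s : seq 'F_p) (t : 'F_p) :
  (0 < sign_count p s t)%N -> exists s1 s2, perm_eq s (s1 ++ s2) /\
    t = \sum_(x <- s1) x - \sum_(x <- s2) x.
Proof.
elim: s t => [|a s IHs] t /=.
  by case: eqVneq => // ->; exists [::], [::]; rewrite !big_nil subrr.
rewrite addn_gt0 => /orP[/IHs|/IHs] [s1 [s2 [sE tE]]].
  exists (a :: s1), s2; rewrite /= perm_cons; split=> //.
  by rewrite big_cons -addrA -tE addrC subrK.
exists s1, (a :: s2); split.
  by rewrite perm_sym (perm_catCA s1 [:: a] s2) perm_cons perm_sym.
by rewrite big_cons opprD addrCA -tE addrC addrK.
Qed.

Section Fourier.
Variables (R : realType) (p : nat).
Hypothesis p_pr : prime p.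

Let p0 : (0 : R) < p%:R. Proof. by rewrite ltr0n prime_gt0. Qed.

(** The real part of an additive character of ['F_p]. *)
Definition cosF (x : 'F_p) : R := cos (pi *+ 2 * (x : nat)%:R / p%:R).

Lemma cosF_nat (n : nat) : cosF n%:R = cos (pi *+ 2 * n%:R / p%:R).
Proof.
rewrite /cosF val_Fp_nat // [in RHS](divn_eq n p) natrD natrM addrC mulrDr mulrDl.
rewrite mulrA mulfK ?gt_eqF // [_ * (n %/ p)%:R]mulr_natr.
by rewrite (periodicn (@cosD2pi R)).
Qed.

Lemma cosFD (x y : 'F_p) : cosF (x + y) + cosF (x - y) = 2 * cosF x * cosF y.
Proof.
have yp := ltnW (Fp_lt p y p_pr).
have -> : x + y = ((x : nat) + (y : nat))%N%:R by rewrite natrD !natr_Zp.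
have -> : x - y = ((x : nat) + (p - (y : nat)))%N%:R.
  by rewrite natrD natrB // !natr_Zp pchar_Fp_0 // sub0r.
rewrite !cosF_nat /cosF.
set a := pi *+ 2 * x%:R / p%:R; set b := pi *+ 2 * y%:R / p%:R.
have -> : pi *+ 2 * ((x : nat) + (y : nat))%:R / p%:R = a + b.
  by rewrite natrD mulrDr mulrDl.
have -> : pi *+ 2 * ((x : nat) + (p - (y : nat)))%:R / p%:R = a - b + pi *+ 2.
  rewrite natrD natrB // mulrDr mulrBr mulrDl mulrBl [X in _ + (X - _)]mulfK ?gt_eqF //.
  by rewrite addrA addrAC.
by rewrite cosD2pi cosD cosB; lra.
Qed.

Lemma cosFN (x : 'F_p) : cosF (- x) = cosF x.
Proof.
have := cosFD 0 x; rewrite add0r sub0r.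
have -> : cosF 0 = 1 by rewrite /cosF mulr0 mul0r cos0.
lra.
Qed.

Lemma cosF_dist0 (x : 'F_p) : cosF x = cos (pi *+ 2 * (dist0 x)%:R / p%:R).
Proof.
rewrite /dist0; case: leqP => _; first by [].
rewrite -cosF_nat natrB ?natr_Zp ?pchar_Fp_0 // ?sub0r ?cosFN //.
exact/ltnW/Fp_lt.
Qed.

(* Doubling the angle at most quadruples [sin^2], so the bound propagates
   from the angles in [pi/4, pi/2] down to 0. *)
Lemma sin2_ge (k : nat) : (2 * k <= p)%N ->
  2 * (k%:R / p%:R) ^+ 2 <= sin (pi * k%:R / p%:R : R) ^+ 2.
Proof.
have [n] := ubnP (p - k)%N; elim: n => // n IHn in k * => ltn lek.
have [->|k0] := posnP k; first by rewrite mul0r expr0n /= mulr0 sqr_ge0.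
have [small|large] := leqP (4 * k) p.
  have := IHn (2 * k)%N; rewrite mulnA => /(_ ltac:(lia) small).
  have -> : pi * (2 * k)%:R / p%:R = (pi * k%:R / p%:R) *+ 2 :> R.
    by rewrite natrM; ring.
  have -> : (2 * k)%:R / p%:R = 2 * (k%:R / p%:R) :> R by rewrite natrM mulrA.
  rewrite sin_mulr2n; set u := k%:R / p%:R; set c := cos _; set s := sin _ => le.
  have c1 : c ^+ 2 <= 1 by rewrite /c cos2sin2 lerBlDr lerDl sqr_ge0.
  have : c ^+ 2 * s ^+ 2 <= 1 * s ^+ 2 by rewrite ler_wpM2r // sqr_ge0.
  move: le; rewrite -mulr_natl !exprMn; lra.
have u2 : k%:R / p%:R <= 2^-1 :> R.
  rewrite ler_pdivrMr // mulrC ler_pdivlMr // -natrM ler_nat mulnC //.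
have u4 : 4^-1 <= k%:R / p%:R :> R.
  by rewrite ler_pdivlMr // mulrC ler_pdivrMr // -natrM ler_nat mulnC ltnW.
have u0 : 0 <= k%:R / p%:R :> R by rewrite divr_ge0.
have u2sq : (k%:R / p%:R) ^+ 2 <= 4^-1 :> R.
  have -> : 4^-1 = 2^-1 ^+ 2 :> R by field.
  by rewrite lerXn2r ?nnegrE.
rewrite -mulrA; set x := pi * _; rewrite sin2cos2.
have pi0 := pi_ge0 R.
have cx : cos x ^+ 2 <= cos (pi / 4) ^+ 2.
  have x0 : pi / 4 <= x by rewrite ler_wpM2l.
  have x1 : x <= pi / 2 by rewrite ler_wpM2l.
  have cx0 : 0 <= cos x by apply: cos_ge0_pihalf; apply/andP; split; lra.
  have c40 : 0 <= cos (pi / 4 : R) by apply: cos_ge0_pihalf; apply/andP; split; lra.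
  rewrite lerXn2r ?nnegrE // le_eqVlt.
  case: (eqVneq x (pi / 4)) => [->|xn]; first by rewrite eqxx.
  have xI : x \in `[0, pi] by rewrite in_itv /=; apply/andP; split; lra.
  have pI : (pi / 4 : R) \in `[0, pi] by rewrite in_itv /=; apply/andP; split; lra.
  by rewrite (ltr_cos pI xI) lt_def xn x0 orbT.
have c4 : cos (pi / 4) ^+ 2 *+ 2 = 1 :> R.
  apply/eqP; rewrite -subr_eq0 -cos_mulr2n -mulrnAl; apply/eqP.
  rewrite -[RHS](@cos_pihalf R); congr cos; lra.
lra.
Qed.

(** For nonzero [t] the sum [S] is invariant under translation, so [cosFD] with shifts by 1 and -1
    gives [2 * S = 2 * cosF 1 * S], and [cosF 1 < 1] forces [S = 0]. *)
Lemma sum_cosF (t : 'F_p) : \sum_(xi : 'F_p) cosF (xi * t) = (p%:R : R) *+ (t == 0).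
Proof.
have [->|tn0] := eqVneq t 0.
  under eq_bigr do rewrite mulr0 /cosF mulr0 mul0r cos0.
  by rewrite sumr_const card_Fp.
have -> : \sum_(xi : 'F_p) cosF (xi * t) = \sum_(xi : 'F_p) cosF xi.
  by rewrite [RHS](reindex_inj (mulIf tn0)).
set S := \sum_(_ : _) _.
have SE (a : 'F_p) : \sum_(xi : 'F_p) cosF (xi + a) = S.
  by rewrite [RHS](reindex_inj (addIr a)).
have : 2 * S = 2 * cosF 1 * S.
  rewrite mulr_natl mulr2n -{1}(SE 1) -{1}(SE (-1)) -big_split mulr_sumr /=.
  by apply: eq_bigr => xi _; rewrite cosFD mulrAC.
have : cosF 1 < 1.
  have := sin2_ge 1 (prime_gt1 p_pr).
  have -> : cosF 1 = 1 - 2 * sin (pi * 1 / p%:R) ^+ 2.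
    rewrite -[1 in LHS](mulr1n (1 : 'F_p)) cosF_nat sin2cos2.
    have -> : pi *+ 2 * 1 / p%:R = (pi * 1 / p%:R) *+ 2 :> R by rewrite mulrnAl mulrnAl.
    by rewrite cos_mulr2n; lra.
  have : 0 < (1 / p%:R : R) ^+ 2 by rewrite exprn_gt0 // divr_gt0.
  lra.
move=> c1 eq; have : (1 - cosF 1) * S = 0 by lra.
by move/eqP; rewrite mulf_eq0 gt_eqF ?subr_gt0 //= => /eqP.
Qed.

(** Fourier inversion: by [cosFD], each new element multiplies the transform by
    [2 * cosF (xi * a)]. *)
Lemma sign_count_fourier (s : seq 'F_p) (t : 'F_p) :
  p%:R * (sign_count p s t)%:R =
    \sum_(xi : 'F_p) cosF (xi * t) * \prod_(a <- s) (2 * cosF (xi * a)).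
Proof.
elim: s t => [|a s IHs] t /=.
  under eq_bigr do rewrite big_nil mulr1.
  by rewrite sum_cosF mulr_natr.
rewrite natrD mulrDr !IHs -big_split; apply: eq_bigr => xi _ /=.
by rewrite big_cons -mulrDl [xi * (t - a)]mulrBr [xi * (t + a)]mulrDr addrC cosFD; ring.
Qed.

(** [|cosF x|] is large for [x] near 0 and near [p / 2], hence the distance of [2 * x]. With [v] the
    quotient, [sin2_ge] gives [cosF x ^+ 2 <= 1 - 2 * v ^+ 2], which is at most
    [expR (- (2 * v ^+ 2))]. *)
Lemma cosF_le (x : 'F_p) :
  `|cosF x| <= expR (- ((dist0 (2 * x))%:R / p%:R) ^+ 2).
Proof.
rewrite -(@ler_pXn2r _ 2) ?nnegrE ?expR_ge0 //.
rewrite real_normK ?num_real // -expRM_natl mulrN.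
apply: le_trans (expR_ge1Dx _).
set y := 2 * x; set u := pi * (dist0 y)%:R / p%:R : R.
have yE : cosF y = cos u ^+ 2 *+ 2 - 1.
  by rewrite -cos_mulr2n cosF_dist0 /u !mulrnAl.
have := cosFD x x; rewrite -mulr2n -[x *+ 2]mulr_natl -/y subrr yE.
have -> : cosF 0 = 1 by rewrite /cosF mulr0 mul0r cos0.
have := sin2_ge (dist0 y) (dist0_le p y p_pr); rewrite -/u sin2cos2.
set c := cos u; set d := cosF x; set v := _ / _; lra.
Qed.

(** Divided by [2 ^ size s], the vanishing Fourier sum has the term 1 at frequency 0, so one of the
    other [p - 1] products has absolute value at least [1 / p]. By [cosF_le], its sum of squares is
    at most [p ^ 2 * ln p], and [p <= 2 ^ k] gives [ln p <= k]. *)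
Lemma concentrated_dilation (k : nat) (s : seq 'F_p) (t : 'F_p) :
    (p <= 2 ^ k)%N -> sign_count p s t = 0%N ->
  exists xi : 'F_p, xi != 0 /\
    (\sum_(a <- s) dist0 (2 * (xi * a))%R ^ 2 <= p ^ 2 * k)%N.
Proof.
move=> pk st0.
suff /existsP[xi /andP[xi0 le]] : [exists xi : 'F_p, (xi != 0) &&
    (\sum_(a <- s) dist0 (2 * (xi * a))%R ^ 2 <= p ^ 2 * k)%N].
  by exists xi.
apply: contraT => /existsPn large.
have small (xi : 'F_p) : xi != 0 -> `|\prod_(a <- s) cosF (xi * a)| < p%:R^-1.
  move=> xi0; have := large xi; rewrite xi0 /= -ltnNge => lt.
  have -> : `|\prod_(a <- s) cosF (xi * a)| = \prod_(a <- s) `|cosF (xi * a)|.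
    by rewrite normr_prod.
  apply: (@le_lt_trans _ _
      (\prod_(a <- s) expR (- ((dist0 (2 * (xi * a)))%:R / p%:R) ^+ 2))).
    by apply: ler_prod => a _; rewrite normr_ge0 cosF_le.
  rewrite -expR_sum sumrN expRN ltf_pV2 ?posrE ?expR_gt0 //.
  have -> : \sum_(a <- s) ((dist0 (2 * (xi * a)))%:R / p%:R) ^+ 2 =
            (\sum_(a <- s) dist0 (2 * (xi * a))%R ^ 2)%N%:R / p%:R ^+ 2 :> R.
    rewrite natr_sum mulr_suml; apply: eq_bigr => a _.
    by rewrite exprMn exprVn natrX.
  apply: (@le_lt_trans _ _ (expR k%:R)).
    apply: (@le_trans _ _ (2 ^+ k)); first by rewrite -natrX ler_nat.
    rewrite -[k%:R]mulr1 expRM_natl lerXn2r ?nnegrE ?expR_ge0 //.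
    exact: (expR_ge1Dx 1).
  by rewrite ltr_expR ltr_pdivlMr ?exprn_gt0 // -natrX -natrM ltr_nat mulnC.
have := sign_count_fourier s t; rewrite st0 mulr0.
under eq_bigr do rewrite big_split /= mulrCA.
rewrite -mulr_sumr => /esym/eqP; rewrite mulf_eq0 prodf_seq_eq0 => /orP[].
  by case/hasP => a _; rewrite pnatr_eq0.
have cos0F : cosF 0 = 1 by rewrite /cosF mulr0 mul0r cos0.
rewrite (bigD1 (0 : 'F_p)) //= mul0r cos0F mul1r.
under eq_bigr do rewrite mul0r cos0F.
rewrite big1 // addrC addr_eq0 => /eqP sumE.
have : `|\sum_(xi : 'F_p | xi != 0) cosF (xi * t) * \prod_(a <- s) cosF (xi * a)|
    <= \sum_(xi : 'F_p | xi != 0) p%:R^-1.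
  apply: le_trans (ler_norm_sum _ _ _) _; apply: ler_sum => xi xi0.
  rewrite normrM -[leRHS]mul1r; apply: ler_pM => //; first exact: cos_max.
  exact/ltW/small.
rewrite sumE normrN1 sumr_const cardC1 card_Fp // -[leRHS]mulr_natl ler_pdivlMr // mul1r.
by rewrite ler_nat -ltnS prednK ?prime_gt0 // ltnn.
Qed.
End Fourier.

(** * Incomplete sequences of residues *)

Section Residues.
Variable p : nat.
Hypothesis p_pr : prime p.

Definition signed_repr (x : 'F_p) : int :=
  if (2 * x < p)%N then x%:Z else x%:Z - p%:Z.

Lemma signed_reprK (x : 'F_p) : (signed_repr x)%:~R = x.
Proof.
rewrite /signed_repr; case: ifP => _; first exact: natr_Zp.
by rewrite rmorphB /= -!pmulrn pchar_Fp_0 // subr0 natr_Zp.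
Qed.

Lemma norm_signed_repr (x : 'F_p) : `|signed_repr x| = (dist0 x)%:Z.
Proof. by have := Fp_lt p x p_pr; rewrite /signed_repr /dist0; case: ifP; lia. Qed.

Lemma dist0_odd (x : 'F_p) : (2 < p)%N -> (2 * dist0 x < p)%N.
Proof.
move=> p2; have := Fp_lt p x p_pr; rewrite /dist0.
have [pE|p_odd] := even_prime p_pr; first by rewrite pE in p2.
by have := odd_double_half p; rewrite p_odd -mul2n; move: (x : nat) => y; lia.
Qed.

Lemma dist0N (x : 'F_p) : dist0 (- x) = dist0 x.
Proof.
have [->|x0] := eqVneq x 0; first by rewrite oppr0.
have xp := Fp_lt p x p_pr; have x1 : (0 < x)%N by rewrite lt0n.
have -> : - x = (p - x)%N%:R.
  by rewrite natrB ?(ltnW xp) // natr_Zp pchar_Fp_0 // sub0r.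
by rewrite /dist0 val_Fp_nat // modn_small; lia.
Qed.

Lemma dist0_int (v : int) : (dist0 (v%:~R : 'F_p) <= `|v|)%N.
Proof.
have natE (n : nat) : (dist0 (n%:R : 'F_p) <= n)%N.
  by rewrite /dist0 val_Fp_nat // (leq_trans (geq_minl _ _)) // leq_mod.
case: v => n; first exact: natE.
by rewrite NegzE mulrNz dist0N; apply: natE.
Qed.

Lemma intr_Fp_eq (u v : int) : (p %| u - v)%Z -> u%:~R = v%:~R :> 'F_p.
Proof.
move=> /dvdzP[k E]; apply/eqP; rewrite -subr_eq0 -rmorphB E /= rmorphM /=.
by rewrite -[p%:~R]pmulrn pchar_Fp_0 // mulr0.
Qed.

End Residues.

(** Removed are one element [a0], at most [n] elements that the dilation leaves farther than [M]
    from 0, and the at most [3 * n] of [incomplete_integers]. *)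
Lemma incomplete_seq (R : realType) (p n m M k : nat) (s : seq 'F_p) (tau : 'F_p) :
    prime p -> (2 < p)%N -> (0 < m <= p)%N -> (0 < n < p ^ 2)%N -> (p <= 2 ^ k)%N ->
    (p ^ 2 * k <= n * M ^ 2)%N -> (144 * (m * M * k) <= n ^ 2)%N ->
    (forall v, count_mem v s <= m)%N ->
    (forall s1 s2, perm_eq s (s1 ++ s2) -> s1 != [::] -> \sum_(x <- s1) x <> tau) ->
  exists b sb sr, [/\ b != 0, perm_eq s (sb ++ sr), (size sb <= 5 * n)%N &
    (\sum_(a <- sr) dist0 (b * a)%R < p)%N].
Proof.
move=> p_pr p2 mp /andP[n0 np] pk Mn Mn2 sm inc.
have p1 := prime_gt1 p_pr.
case: s sm inc => [|a0 s] sm inc.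
  by exists 1, [::], [::]; rewrite big_nil oner_eq0 (ltnW p1).
(* A signed sum of this value would, 2 being invertible, give [s1] with sum [tau - a0]. As [s1] may
   be empty, [a0] was set aside to make the selection nonempty. *)
have st0 : sign_count p s (2 * (tau - a0) - \sum_(x <- s) x) = 0%N.
  apply/eqP; rewrite -leqn0 leqNgt; apply/negP => /sign_count_gt0[s1 [s2 [sE sumE]]].
  apply: (inc (a0 :: s1) s2) => //; first by rewrite /= perm_cons.
  have two0 : (2 : 'F_p) != 0.
    by rewrite -(dvdn_pcharf (pchar_Fp p_pr)) gtnNdvd.
  apply: (mulfI two0); rewrite big_cons mulrDr.
  move: sumE; rewrite (perm_big _ sE) big_cat /=.
  move: (\sum_(x <- s1) _) (\sum_(x <- s2) _) => S1 S2 E.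
  have -> : 2 * S1 = 2 * (tau - a0).
    have -> : 2 * S1 = (S1 - S2) + (S1 + S2) by ring.
    by rewrite -E subrK.
  by ring.
have [xi0 [xi0n0 xiE]] := concentrated_dilation R p p_pr k s _ pk st0.
pose xi := 2 * xi0.
have xin0 : xi != 0.
  rewrite mulf_neq0 //.
  by rewrite -(dvdn_pcharf (pchar_Fp p_pr)) gtnNdvd.
pose far (a : 'F_p) := (M < dist0 (xi * a)%R)%N.
pose so := [seq a <- s | far a]; pose si := [seq a <- s | ~~ far a].
have ssE : perm_eq s (so ++ si) by rewrite perm_sym perm_filterC.
(* Each far element contributes at least [M.+1 ^ 2] to a sum of squares that is at most
   [n * M ^ 2]. *)
have szo : (size so <= n)%N.
  have : (size so * M.+1 ^ 2 <= n * M ^ 2)%N.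
    apply: leq_trans Mn; apply: leq_trans xiE.
    under eq_bigr do rewrite mulrA -/xi.
    rewrite (perm_big _ ssE) big_cat /= (leq_trans _ (leq_addr _ _)) //.
    rewrite /so; elim: (s) => //= a s' IHs; case: ifP => // fa.
    by rewrite big_cons /= mulSn leq_add // leq_exp2r.
  have : (n * M ^ 2 < n * M.+1 ^ 2)%N by rewrite ltn_pmul2l // ltn_exp2r.
  by move=> lt le; have := leq_ltn_trans le lt; rewrite ltn_pmul2r // => /ltnW.
pose h (a : 'F_p) := signed_repr p (xi * a).
pose h' (t : int) : 'F_p := xi^-1 * t%:~R.
have hK : cancel h h' by move=> a; rewrite /h' /h signed_reprK // mulKf.
pose z := map h si.
have h'z : map h' z = si by rewrite /z mapK.
have pull s1 : \sum_(x <- map h' s1) x = xi^-1 * (\sum_(x <- s1) x)%:~R.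
  by rewrite big_map -mulr_sumr rmorph_sum.
(* [4 * k] levels suffice since [n * n < p ^ 4 <= 2 ^ (4 * k)], and [34 * 4 <= 144]. *)
have [||||||zb [zr [g [zE szb /andP[g0 gp] gzr Szr]]]] :=
    incomplete_integers p n m M (4 * k) z (signed_repr p (xi * tau)) p_pr mp n0.
- have lt : (n * n < (p ^ 2) ^ 2)%N by rewrite -mulnn ltn_mul.
  have -> : (2 ^ (4 * k) = ((2 ^ k) ^ 2) ^ 2)%N.
    by rewrite -!expnM; congr (2 ^ _)%N; lia.
  by apply: leq_trans lt _; rewrite !leq_exp2r.
- by apply: leq_trans Mn2; clear; nia.
- move=> _ /mapP[a + ->]; rewrite mem_filter norm_signed_repr // => /andP[+ _].
  by rewrite /far -leqNgt.
- by move=> _ /mapP[a _ ->]; rewrite norm_signed_repr // -PoszM ltz_nat dist0_odd.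
- move=> v; have [/mapP[a _ ->]|/count_memPn -> //] := boolP (v \in z).
  rewrite /z count_map; apply: leq_trans (sm a) => /=.
  apply: leq_trans (leq_addl _ _); rewrite (permP ssE) count_cat.
  apply: leq_trans (leq_addl _ _); apply: sub_count => b /=.
  by rewrite (can_eq hK).
- move=> s1 s2 zE s10; apply/negP => /(intr_Fp_eq p p_pr).
  rewrite signed_reprK // => sumE.
  apply: (inc (map h' s1) (a0 :: so ++ map h' s2)).
  + rewrite perm_sym (perm_catCA _ [:: a0] _) /= perm_cons perm_sym.
    rewrite (permPl ssE) perm_sym perm_catCA perm_cat2l -map_cat -h'z perm_sym.
    exact: perm_map.
  + by rewrite -size_eq0 size_map size_eq0.
  + by rewrite pull sumE mulKf.
have gF : (g%:R : 'F_p) != 0 by rewrite -(dvdn_pcharf (pchar_Fp p_pr)) gtnNdvd.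
(* If [xi * a] is represented by the integer [g * v], then [xi / g] takes [a] to [v], whose distance
   to 0 is at most [|v|]; the sum of the [|v|] is below [p]. *)
exists (xi / g%:R), (a0 :: so ++ map h' zb), (map h' zr); split.
- by rewrite mulf_neq0 ?invr_eq0.
- rewrite /= perm_cons -catA -map_cat (permPl ssE) perm_cat2l -h'z.
  exact: perm_map.
- rewrite /= size_cat size_map; move: (size so) (size zb) szo szb n0 => x y; clear; lia.
rewrite big_map -(ltn_pmul2l g0) -ltz_nat; apply: le_lt_trans Szr.
apply: (@le_trans _ _ (\sum_(u <- zr) (g * (`|u| %/ g))%N%:Z)).
  rewrite big_distrr /=; elim: (zr) gzr => [|u r IHr] gr; first by rewrite !big_nil.
  rewrite !big_cons PoszD lerD ?IHr //; last by move=> v vr; apply: gr; rewrite inE vr orbT.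
  rewrite lez_nat leq_pmul2l //.
  have /dvdzP[v uE] := gr u (mem_head _ _).
  have -> : xi / g%:R * h' u = v%:~R.
    rewrite /h' uE rmorphM /= -[g%:~R]pmulrn mulrACA divff // mul1r.
    by rewrite mulrCA mulVf // mulr1.
  rewrite uE abszM absz_nat mulnK //.
  exact: dist0_int.
rewrite big_seq [leRHS]big_seq; apply: ler_sum => u uzr.
by rewrite mulnC divnK //; have := gzr u uzr.
Qed.

(** The least [M] with the first property, if at least 2, satisfies [n * (M - 1) ^ 2 < p ^ 2 * k]
    and [M ^ 2 <= 4 * (M - 1) ^ 2], whence the factor 4 of the hypothesis. For [M = 1] the bound
    [n <= p ^ 2] takes over. *)
Lemma choose_radius (p m k n : nat) :
    (0 < k)%N -> (0 < n <= p ^ 2)%N ->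
    (4 * (144 * (m * k)) ^ 2 * (p ^ 2 * k) <= n ^ 5)%N ->
  exists M, (p ^ 2 * k <= n * M ^ 2)%N /\ (144 * (m * M * k) <= n ^ 2)%N.
Proof.
move=> k0 /andP[n0 np] le.
have exM : exists M, (p ^ 2 * k <= n * M ^ 2)%N.
  by exists (p * k)%N; rewrite expnMn mulnCA leq_pmul2l; [nia | lia].
case: (ex_minnP exM) => M nM Mmin; exists M; split=> //.
have -> : (144 * (m * M * k) = 144 * (m * k) * M)%N.
  by rewrite -!mulnA (mulnC M).
set Y := (144 * _)%N in le *.
rewrite -(@leq_exp2r _ _ 2) // expnMn -expnM.
case: M nM Mmin => [|[|M]] nM Mmin.
- by rewrite mulnC.
- have p0 : (0 < 4 * (p ^ 2 * k))%N by lia.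
  rewrite -(leq_pmul2r p0) exp1n muln1.
  have -> : (Y ^ 2 * (4 * (p ^ 2 * k)) = 4 * Y ^ 2 * (p ^ 2 * k))%N by ring.
  apply: leq_trans le _; rewrite expnSr leq_mul2l; nia.
have lt : (n * M.+1 ^ 2 < p ^ 2 * k)%N.
  by rewrite ltnNge; apply/negP => /Mmin; rewrite ltnn.
rewrite -(leq_pmul2r n0) -expnSr; apply: leq_trans le.
apply: (@leq_trans (4 * Y ^ 2 * (n * M.+1 ^ 2))); last by rewrite leq_mul2l ltnW ?orbT.
have sq : (M.+2 ^ 2 <= 4 * M.+1 ^ 2)%N by nia.
have -> : (4 * Y ^ 2 * (n * M.+1 ^ 2) = Y ^ 2 * n * (4 * M.+1 ^ 2))%N by ring.
by rewrite mulnAC leq_mul2l sq orbT.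
Qed.

(** * Numerical bounds for [f] *)

Section Size.
Variable R : realType.

(** [expR (- 6^-1)] is at least 5/6, and [(6/5) ^ 6 < 3]. This yields [ln p >= 1] for [p >= 3]. *)
Lemma expR1_le3 : expR 1 <= 3 :> R.
Proof.
have -> : expR 1 = expR (- 6^-1) ^- 6 :> R.
  by rewrite -expRM_natl -expRN; congr expR; lra.
have : 1 + - 6^-1 <= expR (- 6^-1) :> R := expR_ge1Dx _.
set e := expR _ => le; rewrite -[3]invrK lef_pV2 ?posrE ?exprn_gt0 ?expR_gt0 //.
apply: (@le_trans _ _ ((1 + - 6^-1) ^+ 6)); first by lra.
by rewrite lerXn2r ?nnegrE ?expR_ge0 //; lra.
Qed.

(** From [expR (1/2) <= 2] and [2 ^ (up_log 2 p - 1) <= p] one gets [up_log 2 p <= 2 * ln p + 1],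
    and [ln p >= 1]. *)
Lemma up_log_le_ln (p : nat) : (2 < p)%N -> (up_log 2 p)%:R <= 3 * ln (p%:R : R).
Proof.
move=> p2; have p0 : (0 : R) < p%:R by rewrite ltr0n; lia.
have ln1 : 1 <= ln (p%:R : R).
  rewrite -ler_expR lnK ?posrE //; apply: le_trans expR1_le3 _.
  by rewrite ler_nat.
have : (0 < up_log 2 p)%N.
  by rewrite up_log_gt0; lia.
case E : (up_log 2 p) => [//|k] _.
have kp : (2 ^ k <= p)%N.
  by rewrite -[k]/(k.+1.-1) -E ltnW // up_log_gtn // ltnW.
have : k%:R * 2^-1 <= ln (p%:R : R).
  rewrite -ler_expR lnK ?posrE // expRM_natl.
  apply: (@le_trans _ _ (2 ^+ k)); last by rewrite -natrX ler_nat.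
  rewrite lerXn2r ?nnegrE ?expR_ge0 //.
  have := expR_ge1Dx (- 2^-1 : R); rewrite expRN => le.
  rewrite -[leLHS]invrK -[leRHS]invrK lef_pV2 ?posrE ?invr_gt0 ?expR_gt0 //.
  by apply: le_trans le; lra.
by rewrite -[k.+1%:R]natr1; lra.
Qed.

(** In the fifth power, [30/13 >= 2] gives [(p * m) ^ 2], and [ln p ^ 10] absorbs [(3 * ln p) ^ 3]
    up to the factor 27. Rounding down costs at most a factor 2, and [4 ^ 5 = 32 * 2 ^ 5] leaves
    room for 27. *)
Lemma f_size (p m : nat) : (2 < p)%N -> (0 < m)%N ->
  exists F : nat, [/\ f R p m = F%:Z, (0 < F)%N &
    ((p * m) ^ 2 * (up_log 2 p) ^ 3 <= (4 * F) ^ 5)%N].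
Proof.
move=> p2 m0; have p0 : (0 : R) < p%:R by rewrite ltr0n; lia.
have ln1 : 1 <= ln (p%:R : R).
  rewrite -ler_expR lnK ?posrE //; apply: le_trans expR1_le3 _.
  by rewrite ler_nat.
have kl := up_log_le_ln p p2.
rewrite /f; set l := ln _ in ln1 kl *; set a : R := (p * m)%:R.
have a1 : 1 <= a by rewrite ler1n muln_gt0 m0; lia.
set w := a `^ _; set x := w * _.
have w1 : 1 <= w by rewrite -(powRr0 a) ler_powR // divr_ge0.
have w5 : a ^+ 2 <= w ^+ 5.
  rewrite -!powR_mulrn ?(le_trans ler01) // /w -powRrM ler_powR //.
  by rewrite mulrAC ler_pdivlMr // -!natrM ler_nat.
have x1 : 1 <= x by rewrite -[1]mulr1 ler_pM // exprn_ege1.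
have F1 : 1 <= Num.floor x by rewrite floor_ge_int.
have [F FE] : exists F : nat, Num.floor x = F%:Z.
  by exists `|Num.floor x|%N; rewrite gez0_abs // (le_trans _ F1).
exists F; rewrite FE in F1; split=> //.
have xF : x <= 2 * F%:R.
  have := floorD1_gt x; rewrite FE rmorphD /= -pmulrn.
  have : (1 : R) <= F%:R by rewrite ler1n.
  lra.
rewrite -(ler_nat R) natrX natrM; change (4%:R : R) with (4 : R).
have x5 : x ^+ 5 <= (2 * F%:R) ^+ 5.
  by rewrite lerXn2r ?nnegrE // ?(le_trans _ xF) // (le_trans _ x1).
have l3 : (up_log 2 p)%:R ^+ 3 <= 27 * l ^+ 10.
  apply: (@le_trans _ _ ((3 * l) ^+ 3)).
    have l0 : 0 <= 3 * l by lra.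
    by rewrite lerXn2r ?nnegrE.
  have : l ^+ 3 <= l ^+ 10 by rewrite ler_weXn2l.
  by rewrite exprMn; lra.
have : a ^+ 2 * (27 * l ^+ 10) <= 27 * x ^+ 5.
  rewrite mulrCA ler_pM2l // /x exprMn -exprM ler_wpM2r //.
  by rewrite exprn_ge0 // (le_trans _ ln1).
have : a ^+ 2 * (up_log 2 p)%:R ^+ 3 <= a ^+ 2 * (27 * l ^+ 10).
  by rewrite ler_wpM2l // sqr_ge0.
rewrite -/a natrX => le1 le2; rewrite natrX.
apply: le_trans le1 _; apply: le_trans le2 _.
have : 0 <= (2 * F%:R : R) ^+ 5 by rewrite exprn_ge0.
rewrite natrM; have -> : (4 * F%:R : R) = 2 * (2 * F%:R) by ring.
by rewrite [X in _ -> _ <= X]exprMn; lra.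
Qed.

End Size.

(** Two elements equal to 1 have the subset sums 1 and 0, so at most one element is nonzero. The
    prime 2 is treated apart because signed sums require halving. *)
Lemma incomplete_seq2 (s : seq 'F_2) (tau : 'F_2) :
    (forall s1 s2, perm_eq s (s1 ++ s2) -> s1 != [::] -> \sum_(x <- s1) x <> tau) ->
  (\sum_(a <- s) dist0 (p := 2) a < 2)%N.
Proof.
move=> inc; pose w := [seq a <- s | a != 0].
have swE : perm_eq s (w ++ [seq a <- s | ~~ (a != 0)]).
  by rewrite perm_sym perm_filterC.
rewrite (perm_big _ swE) big_cat /= [X in (_ + X)%N]big_filter.
rewrite [X in (_ + X)%N]big1 ?addn0; last first.
  by move=> a /negPn/eqP ->.
case wE : w swE => [|a [|b r]] swE; rewrite ?big_nil // ?big_cons ?big_nil ?addn0.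
  by have := dist0_le 2 a isT; lia.
have F2 (x : 'F_2) : x \in w -> x = 1.
  by rewrite mem_filter => /andP[+ _]; case: x => [[|[|]]] // ? _; apply: val_inj.
have a1 : a = 1 by apply: F2; rewrite wE mem_head.
have b1 : b = 1 by apply: F2; rewrite wE !inE eqxx orbT.
have [t0|t0] := eqVneq tau 0.
  have := inc [:: a; b] (r ++ [seq a <- s | ~~ (a != 0)]) swE isT.
  by rewrite !big_cons big_nil a1 b1 t0; case; apply: val_inj.
have := inc [:: a] (b :: r ++ [seq a <- s | ~~ (a != 0)]) swE isT.
rewrite big_cons big_nil a1 addr0; case.
by case: tau t0 {inc} => [[|[|]]] // ? _; apply: val_inj.
Qed.

(** * Multisets as lists, and the conclusion *)

Lemma incompleteP (p : nat) (A : {mset 'F_p}%mset) : incomplete A ->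
  exists tau : 'F_p, forall s1 s2, perm_eq A (s1 ++ s2) -> s1 != [::] ->
    \sum_(x <- s1) x <> tau.
Proof.
move=> inc; apply: contrapT => none; apply: inc; apply/seteqP; split=> // tau _.
apply: contrapT => ntau; apply: none; exists tau => s1 s2 As s1n sumE; apply: ntau.
exists (seq_mset s1); split.
- apply/forallP => x; rewrite mset_seqE -[leqRHS]count_mem_mset (permP As) count_cat.
  exact: leq_addr.
- apply: contraNneq s1n => s0; rewrite -size_eq0 -(perm_size (perm_eq_seq_mset s1)) s0.
  by rewrite enum_mset0.
- by rewrite (perm_big _ (perm_eq_seq_mset s1)).
Qed.

Lemma split_mset (p : nat) (A : {mset 'F_p}%mset) (b : 'F_p) (sb sr : seq 'F_p) :
    perm_eq A (sb ++ sr) ->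
  exists Ab : {mset 'F_p}%mset, [/\ (Ab `<=` A)%mset, size Ab = size sb &
    (\sum_(a <- dilate b (A `\` Ab)%mset) dist0 a = \sum_(a <- sr) dist0 (b * a)%R)%N].
Proof.
move=> AE; have Ax x : A x = (count_mem x sb + count_mem x sr)%N.
  by rewrite -count_mem_mset (permP AE) count_cat.
exists (seq_mset sb); split.
- by apply/forallP => x; rewrite mset_seqE Ax leq_addr.
- exact/perm_size/perm_eq_seq_mset.
rewrite /dilate (perm_big _ (perm_eq_seq_mset _)) big_map.
apply: perm_big; apply/permP => P.
have -> : (A `\` seq_mset sb)%mset = seq_mset sr.
  by apply/msetP => x; rewrite msetE2 !mset_seqE Ax addKn.
exact/permP/perm_eq_seq_mset.
Qed.

Theorem theorem2p3 (R : realType) :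
  exists c2 : R, 0 < c2 /\
    forall (p m : nat) (A : {mset 'F_p}%mset),
      prime p -> (1 <= m <= p)%N ->
      incomplete A -> (max_mult A <= m)%N ->
      exists (b : 'F_p) (Ab : {mset 'F_p}%mset),
        [/\ b != 0,
            (Ab `<=` A)%mset,
            (size Ab)%:R <= c2 * (f R p m)%:~R
          & (\sum_(a <- dilate b (A `\` Ab)%mset) dist0 a < p)%N].
Proof.
(* [240 = 5 * 48]: at most [5 * n] elements are removed, with [n = 48 * F]. *)
exists 240; split=> // p m A p_pr mp /incompleteP[tau inc] mA.
have Am v : (count_mem v A <= m)%N.
  by rewrite count_mem_mset (leq_trans _ mA) // /max_mult (leq_bigmax v).
suff main : exists (b : 'F_p) (sb sr : seq 'F_p),
  [/\ b != 0, perm_eq A (sb ++ sr),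
    (size sb)%:R <= 240 * (f R p m)%:~R :> R &
    (\sum_(a <- sr) dist0 (b * a)%R < p)%N].
  case: main => b [sb [sr [b0 AE szb sumr]]].
  have [Ab [AbA sAb sumE]] := split_mset p A b sb sr AE.
  by exists b, Ab; rewrite sAb sumE.
have [p2|p_odd] := even_prime p_pr.
  subst p; exists 1, [::], A; split; rewrite ?oner_eq0 //.
    by rewrite mulr_ge0 // ler0z floor_ge_int mulr_ge0 ?powR_ge0 ?sqr_ge0.
  under eq_bigr do rewrite mul1r.
  exact: incomplete_seq2 inc.
have p3 : (2 < p)%N by rewrite odd_prime_gt2.
have /andP[m0 _] := mp.
have [F [FE F0 Fle]] := f_size R p m p3 m0; rewrite FE.
set k := up_log 2 p in Fle.
(* [n ^ 5] is [12 ^ 5 * (4 * F) ^ 5], enough for the [4 * 12 ^ 4 * (p * m) ^ 2 * k ^ 3] that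
   [choose_radius] asks for. *)
pose n := (48 * F)%N.
have size240 q : (q <= 5 * n)%N -> q%:R <= 240 * (F%:Z)%:~R :> R.
  move=> le; rewrite -pmulrn -[240]/(240%:R) -natrM ler_nat; lia.
have [small|large] := leqP (size A) (5 * n).
  exists 1, A, [::]; rewrite oner_eq0 cats0 big_nil prime_gt0 //; split=> //.
  exact: size240.
(* With [5 * n < size A] and [m <= p] this gives [n < p ^ 2]. *)
have szA : (size A <= p * m)%N.
  have -> : size A = (\sum_(x : 'F_p) count_mem x A)%N.
    elim: (enum_mset A) => [|a s IHs] /=; first by rewrite big1.
    rewrite big_split /= -IHs (bigD1 a) //= eqxx big1 // => x.
    by rewrite eq_sym => /negPf ->.
  by rewrite -[X in (X * m)%N](card_Fp p_pr) -sum_nat_const leq_sum.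
have np : (n < p ^ 2)%N by nia.
have n0 : (0 < n)%N by rewrite /n; lia.
have k0 : (0 < k)%N by rewrite up_log_gt0; lia.
have [||M [M1 M2]] := choose_radius p m k n k0.
- by rewrite n0 ltnW.
- have -> : (n = 12 * (4 * F))%N by rewrite /n mulnA.
  rewrite [leqRHS]expnMn; apply: leq_trans _ (leq_mul (leqnn _) Fle).
  have -> : (144 = 12 ^ 2)%N by [].
  have -> : (4 * (12 ^ 2 * (m * k)) ^ 2 * (p ^ 2 * k) =
             (4 * 12 ^ 4) * ((p * m) ^ 2 * k ^ 3))%N by ring.
  by rewrite leq_mul2r expnS leq_mul2r orbT.
have [||||||b [sb [sr [b0 AE szb sumr]]]] :=
  incomplete_seq R p n m M k A tau p_pr p3 mp.
all: try by [].
- by rewrite n0.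
- exact: up_logP.
by exists b, sb, sr; split=> //; apply: size240.
Qed.
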